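(* Let $G=(V,E)$ be a graph with at least six vertices and let $q\in\Sigma^V$ be such that $(G,q)$ is completely full and infinitesimally rigid in $\Sigma$. Suppose that for every $e\in E$ the framework $(G-e,q)$ is not infinitesimally rigid in $\Sigma$. Then $G$ is $(3,4)$-tight.
   Context: Let $\Sigma=\{(x,y,z,w)\in\mathbb{R}^4: x^2+y^2+z^2=1\}$ and $\pi(x,y,z,w)=(x,y,z)$. An infinitesimal rigid motion of $\mathbb{R}^4$ is an affine map $\eta(x)=Mx+c$ with $M$ a $4\times4$ skew-symmetric matrix and $c\in\mathbb{R}^4$; $\mathcal{T}(\Sigma)$ is the set of such $\eta$ with $\pi(\eta(x))\cdot\pi(x)=0$ for all $x\in\Sigma$. For a finite simple graph $G=(V,E)$ and $q\in\Sigma^V$, an infinitesimal flex of $(G,q)$ is $m\in(\mathbb{R}^4)^V$ with $(m_u-m_v)\cdot(q_u-q_v)=0$ for all $uv\in E$ and $\pi(m_v)\cdot\pi(q_v)=0$ for all $v\in V$; it is trivial if $m_v=\eta(q_v)$ for all $v$ for some $\eta\in\mathcal{T}(\Sigma)$; $(G,q)$ is infinitesimally rigid if every infinitesimal flex is trivial. $(G,q)$ is full in $\Sigma$ if the map $\mathcal{T}(\Sigma)\to(\mathbb{R}^4)^V$, $\eta\mapsto(\eta(q_v))_{v\in V}$, is injective, and completely full if every subframework $(H,q|_{V(H)})$, $H$ a subgraph of $G$ with at least 6 vertices, is full. $G$ is $(3,4)$-tight if $|E|=3|V|-4$ and $|E'|\leq 3|V'|-4$ for every subgraph $(V',E')$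 with at least one edge. *)

(* Defs.v *)
From HB Require Import structures.
From mathcomp Require Import all_boot all_order all_algebra.
From mathcomp Require Import reals.
Set Implicit Arguments.
Unset Strict Implicit.
Unset Printing Implicit Defensive.
Import Order.TTheory GRing.Theory Num.Theory.
Local Open Scope ring_scope.

(* A simple graph whose vertices lie in a finite ambient type T. The vertex set
   is a field so that a subgraph H of G is again an [sgraph T], and the
   restriction of a placement q : T -> R^4 to V(H) is q itself: every notion
   below only inspects q on the vertex set of the graph. *)
Record sgraph (T : finType) := SGraph {
  verts : {set T};
  edges : {set {set T}};
  edgesP : [forall e in edges, (#|e| == 2) && (e \subset verts)]
}.

Definition subgraph (T : finType) (H G : sgraph T) : bool :=
  (verts H \subset verts G) && (edges H \subset edges G).

Lemma del_edgeP (T : finType) (G : sgraph T) (e : {set T}) :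
  [forall f in edges G :\ e, (#|f| == 2) && (f \subset verts G)].
Proof.
apply/forall_inP => f; rewrite inE => /andP[_ fG].
by move/forall_inP: (edgesP G); apply.
Qed.

Definition del_edge (T : finType) (G : sgraph T) (e : {set T}) : sgraph T :=
  SGraph (del_edgeP G e).

(* The counts are written additively because subtraction on nat truncates. *)
Definition tight34 (T : finType) (G : sgraph T) : Prop :=
  (#|edges G| + 4 = 3 * #|verts G|)%N /\
  forall H : sgraph T, subgraph H G -> (0 < #|edges H|)%N ->
    (#|edges H| + 4 <= 3 * #|verts H|)%N.

Section Cylinder.
Variable R : realType.

Definition dot n (u v : 'cV[R]_n) : R := \sum_i u i 0 * v i 0.

(* (x, y, z, w) |-> (x, y, z) *)
Definition proj (p : 'cV[R]_4) : 'cV[R]_3 := usubmx (p : 'cV[R]_(3 + 1)).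

Definition Sigma : {pred 'cV[R]_4} :=
  [pred p : 'cV[R]_4 | \sum_i proj p i 0 ^+ 2 == 1].

Definition inf_rigid_motion (eta : 'cV[R]_4 -> 'cV[R]_4) : Prop :=
  exists (M : 'M[R]_4) (c : 'cV[R]_4),
    M^T = - M /\ forall x, eta x = M *m x + c.

(* eta belongs to T(Sigma) *)
Definition tangent_motion (eta : 'cV[R]_4 -> 'cV[R]_4) : Prop :=
  inf_rigid_motion eta /\
  forall x, x \in Sigma -> dot (proj (eta x)) (proj x) = 0.

Section Framework.
Variables (T : finType) (G : sgraph T) (q : T -> 'cV[R]_4).

Definition inf_flex (m : T -> 'cV[R]_4) : Prop :=
  (forall u v, [set u; v] \in edges G -> dot (m u - m v) (q u - q v) = 0) /\
  (forall v, v \in verts G -> dot (proj (m v)) (proj (q v)) = 0).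

Definition trivial_flex (m : T -> 'cV[R]_4) : Prop :=
  exists eta, tangent_motion eta /\ forall v, v \in verts G -> m v = eta (q v).

Definition inf_rigid : Prop := forall m, inf_flex m -> trivial_flex m.

Definition full : Prop :=
  forall eta1 eta2, tangent_motion eta1 -> tangent_motion eta2 ->
    (forall v, v \in verts G -> eta1 (q v) = eta2 (q v)) -> eta1 =1 eta2.

End Framework.

Definition completely_full (T : finType) (G : sgraph T) (q : T -> 'cV[R]_4) :
    Prop :=
  forall H : sgraph T, subgraph H G -> (6 <= #|verts H|)%N -> full H q.

End Cylinder.

(* Main.v *)
(* The rigidity map sends a velocity field on the n vertices to its n normal
   components and |E| edge stretchings. By minimality, deleting an edge e admits
   a nontrivial flex, which cannot have zero stretching on e; these flexes are
   dual to the edge constraints, and (v |-> y_v q_v) takes arbitrary values y on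
   the normal constraints since |proj q_v| = 1. So the rigidity map is onto and
   its kernel has dimension 4n - n - |E|. Fullness embeds the 4-dimensional
   T(Sigma) in the kernel, and rigidity makes this embedding onto. Duality is
   inherited by subgraphs, so those with at least 6 vertices satisfy
   |E'| <= 3n' - 4; smaller ones satisfy it because |E'| <= C(n', 2). *)
From HB Require Import structures.
Require Import Defs.
From mathcomp Require Import all_boot all_order all_algebra.
From mathcomp Require Import reals boolp ring lra zify.
Set Implicit Arguments.
Unset Strict Implicit.
Unset Printing Implicit Defensive.
Import GRing.Theory Num.Theory.
Local Open Scope ring_scope.

(** * Coordinates, the projection and the dot product *)

Local Notation o0 := (@Ordinal 4 0 isT).
Local Notation o1 := (@Ordinal 4 1 isT).
Local Notation o2 := (@Ordinal 4 2 isT).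
Local Notation o3 := (@Ordinal 4 3 isT).

Lemma ord4_ind (P : 'I_4 -> Prop) : P o0 -> P o1 -> P o2 -> P o3 -> forall i, P i.
Proof.
by move=> P0 P1 P2 P3 [[|[|[|[|//]]]] i]; rewrite (bool_irrelevance i isT).
Qed.

Section Rigidity.
Variable R : realType.

Lemma sum_ord4 (F : 'I_4 -> R) : \sum_i F i = F o0 + F o1 + F o2 + F o3.
Proof.
rewrite !big_ord_recl big_ord0 addr0 !addrA.
by congr (F _ + F _ + F _ + F _); apply: val_inj.
Qed.

Lemma sum_proj (F : R -> R -> R) (a b : 'cV[R]_4) :
  \sum_i F (proj a i 0) (proj b i 0) =
  F (a o0 0) (b o0 0) + F (a o1 0) (b o1 0) + F (a o2 0) (b o2 0).
Proof.
rewrite !big_ord_recl big_ord0 addr0 !addrA /proj !mxE.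
by congr (F (a _ _) (b _ _) + F (a _ _) (b _ _) + F (a _ _) (b _ _));
  apply: val_inj.
Qed.

Lemma dot_projE (a b : 'cV[R]_4) : dot (proj a) (proj b) =
  a o0 0 * b o0 0 + a o1 0 * b o1 0 + a o2 0 * b o2 0.
Proof. exact: (sum_proj *%R). Qed.

Lemma SigmaP (p : 'cV[R]_4) : reflect (dot (proj p) (proj p) = 1) (p \in @Sigma R).
Proof. exact: eqP. Qed.

Lemma dotDl n (a b c : 'cV[R]_n) : dot (a + b) c = dot a c + dot b c.
Proof. by rewrite -big_split; apply: eq_bigr => i _; rewrite mxE mulrDl. Qed.

Lemma dotZl n k (a c : 'cV[R]_n) : dot (k *: a) c = k * dot a c.
Proof. by rewrite big_distrr /=; apply: eq_bigr => i _; rewrite mxE mulrA. Qed.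

Lemma dotNN n (a b : 'cV[R]_n) : dot (- a) (- b) = dot a b.
Proof. by apply: eq_bigr => i _; rewrite !mxE mulrNN. Qed.

Lemma dot0l n (a : 'cV[R]_n) : dot 0 a = 0.
Proof. by apply: big1 => i _; rewrite mxE mul0r. Qed.

Lemma proj_is_linear : linear (@proj R).
Proof. by move=> k a b; apply/colP => i; rewrite !mxE. Qed.
HB.instance Definition _ := GRing.isLinear.Build R _ _ _ (@proj R) proj_is_linear.

(** * Parametrization of the tangent rigid motions *)

(* (k0, k1, k2) is the axial vector of the rotation of R^3, and k3 the speed of
   the translation along the w-axis; T(Sigma) consists of these four-parameter
   fields, because skew-symmetry kills the diagonal of M and testing tangency at
   (e_i, 0) and (e_i, 1) kills c_i and M_iw for i <> w. *)
Definition motion (k x : 'cV[R]_4) : 'cV[R]_4 :=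
  \col_(i < 4) [:: k o1 0 * x o2 0 - k o2 0 * x o1 0;
                   k o2 0 * x o0 0 - k o0 0 * x o2 0;
                   k o0 0 * x o1 0 - k o1 0 * x o0 0;
                   k o3 0]`_i.

Lemma motion_is_linear x : linear (motion^~ x).
Proof.
by move=> a k l; apply/colP; apply: ord4_ind; rewrite !mxE /=; ring.
Qed.

Lemma tangent_motion_motion k : tangent_motion (motion k).
Proof.
split=> [|x _]; last by rewrite dot_projE !mxE /=; ring.
(* The upper block is the cross product with [(k0, k1, k2)]; the empty last row reads as zeros by
   the default value of [nth]. *)
pose A : 'M[R]_4 := \matrix_(i < 4, j < 4)
  (nth [::] [:: [:: 0; - k o2 0; k o1 0; 0]; [:: k o2 0; 0; - k o0 0; 0];
      [:: - k o1 0; k o0 0; 0; 0]; [::]] i)`_j.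
exists A, (\col_(i < 4) (if i == o3 then k o3 0 else 0)); split.
  by apply/matrixP; apply: ord4_ind; apply: ord4_ind; rewrite !mxE /= ?oppr0 ?opprK.
by move=> x; apply/colP; apply: ord4_ind; rewrite !mxE sum_ord4 !mxE /=; ring.
Qed.

Lemma tangent_motionP eta :
  tangent_motion eta -> exists k, eta =1 motion k.
Proof.
case=> -[A [c [skA etaE]] tan].
have skew i j : A j i = - A i j by move/matrixP: skA => /(_ i j); rewrite !mxE.
have diag i : A i i = 0 by move: (skew i i); lra.
have tanE i w : i != o3 -> A i o3 * w + c i 0 = 0.
  pose p : 'cV[R]_4 := \col_j (if j == i then 1 else if j == o3 then w else 0).
  move=> i3; have pS : p \in @Sigma R.
    by apply/SigmaP; rewrite dot_projE !mxE; move: i {p} i3;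
       apply: ord4_ind => //= _; ring.
  have := tan p pS; rewrite etaE dot_projE !mxE !sum_ord4 !mxE.
  move: i i3 {p pS}; apply: ord4_ind => //= _; rewrite !diag; lra.
have c0 i : i != o3 -> c i 0 = 0 by move=> i3; move: (tanE i 0 i3); rewrite mulr0 add0r.
have A0 i : i != o3 -> A i o3 = 0.
  by move=> i3; move: (tanE i 1 i3); rewrite mulr1 c0 // addr0.
(* The axial vector of the rotation block, then the speed along the w-axis. *)
pose k : 'cV[R]_4 := \col_(i < 4) [:: A o2 o1; A o0 o2; A o1 o0; c o3 0]`_i.
exists k => x; rewrite etaE; apply/colP; apply: ord4_ind;
  rewrite !mxE sum_ord4 /= ?diag.
- by rewrite (skew o1 o0) A0 // c0 //; ring.
- by rewrite (skew o2 o1) A0 // c0 //; ring.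
- by rewrite (skew o0 o2) A0 // c0 //; ring.
- by rewrite !(skew _ o3) !A0 //; ring.
Qed.

Lemma motion_inj k l : motion k =1 motion l -> k = l.
Proof.
move=> kl; have E j i : motion k (delta_mx j 0) i 0 = motion l (delta_mx j 0) i 0.
  by rewrite kl.
apply/colP; apply: ord4_ind.
- by have := E o1 o2; rewrite !mxE /=; lra.
- by have := E o2 o0; rewrite !mxE /=; lra.
- by have := E o0 o1; rewrite !mxE /=; lra.
- by have := E o0 o3; rewrite !mxE.
Qed.

End Rigidity.

(** * The rigidity map and its kernel *)

Section RigidityMap.
Variables (R : realType) (T : finType) (G : sgraph T) (q : T -> 'cV[R]_4).

(* Summing over ordered pairs avoids choosing endpoints of e; on an edge it
   gives twice the usual constraint. *)
Definition stretch (m : T -> 'cV[R]_4) (e : {set T}) : R :=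
  \sum_(u in e) \sum_(v in e) dot (m u - m v) (q u - q v).

Lemma stretch_pair m u v : u != v ->
  stretch m [set u; v] = dot (m u - m v) (q u - q v) *+ 2.
Proof.
move=> uv; rewrite /stretch !big_setU1 ?inE //= !big_set1 !big_setU1 ?inE //= !big_set1.
by rewrite !subrr !dot0l add0r addr0 -[m v - _]opprB -[q v - _]opprB dotNN mulr2n.
Qed.

Lemma eq_stretch m m' (e : {set T}) : {in e, m =1 m'} -> stretch m e = stretch m' e.
Proof.
by move=> mm'; apply: eq_bigr => u ue; apply: eq_bigr => v ve; rewrite !mm'.
Qed.

Lemma stretch_is_linear e a m m' :
  stretch (fun v => a *: m v + m' v) e = a * stretch m e + stretch m' e.
Proof.
rewrite /stretch big_distrr -big_split /=; apply: eq_bigr => u _.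
rewrite big_distrr -big_split /=; apply: eq_bigr => v _.
by rewrite -dotZl -dotDl; congr dot; rewrite scalerBr opprD addrACA.
Qed.

Lemma edge_card e : e \in edges G -> #|e| = 2.
Proof. by move=> eG; have /forall_inP/(_ e eG)/andP[/eqP] := edgesP G. Qed.

Lemma edge_sub e : e \in edges G -> e \subset verts G.
Proof. by move=> eG; have /forall_inP/(_ e eG)/andP[] := edgesP G. Qed.

(** Edges have distinct endpoints, so [stretch] is twice the edge constraint, and the factor 2
    cancels in [R]. *)
Lemma inf_flexP m : inf_flex G q m <->
  (forall e, e \in edges G -> stretch m e = 0) /\
  (forall v, v \in verts G -> dot (proj (m v)) (proj (q v)) = 0).
Proof.
split=> -[mE mV]; split=> //.
  move=> e eG; have /eqP/cards2P[u [v [uv e_def]]] := edge_card eG.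
  by rewrite e_def stretch_pair // mE -?e_def // mul0rn.
move=> u v uvG; have uv : u != v.
  by move: (edge_card uvG); rewrite cards2; case: (u != v).
by have /eqP := mE _ uvG; rewrite stretch_pair // mulrn_eq0 /= => /eqP.
Qed.

(** Velocities are indexed by the vertices of [G] alone, not by [T], so that their space has
    dimension [4 * #|verts G|]. *)
Let V := {v | v \in verts G}.
Let E := {e | e \in edges G}.

(** The value 0 off [verts G] is harmless: edges of [G] have both endpoints in [verts G]. *)
Definition extend (x : {ffun V -> 'cV[R]_4}) (v : T) : 'cV[R]_4 :=
  oapp x 0 (insub v).

Lemma extend_val x (v : V) : extend x (val v) = x v.
Proof. by rewrite /extend valK. Qed.

Lemma extend_restrict (m : T -> 'cV[R]_4) :
  {in verts G, extend [ffun v : V => m (val v)] =1 m}.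
Proof. by move=> v vG; rewrite /extend insubT /= ffunE. Qed.

Definition rigidity_map (x : {ffun V -> 'cV[R]_4}) : {ffun V + E -> R^o} :=
  [ffun i => match i with
             | inl v => dot (proj (x v)) (proj (q (val v)))
             | inr e => stretch (extend x) (val e)
             end].

Lemma rigidity_map_is_linear : linear rigidity_map.
Proof.
move=> a x y; apply/ffunP=> -[v|e]; rewrite !ffunE.
  by rewrite linearP dotDl dotZl.
rewrite -stretch_is_linear; apply: eq_stretch => v _.
by rewrite /extend; case: insubP => [u _ _|_] /=; rewrite ?ffunE ?scaler0 ?addr0.
Qed.
HB.instance Definition _ :=
  GRing.isLinear.Build R _ _ _ rigidity_map rigidity_map_is_linear.

Lemma lker_rigidity_map x :
  x \in lker (linfun rigidity_map) <-> inf_flex G q (extend x).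
Proof.
rewrite memv_ker lfunE /= inf_flexP; split=> [/eqP/ffunP x0 | [xE xV]].
  split=> [e eG | v vG].
    by have := x0 (inr (exist _ e eG)); rewrite !ffunE.
  by have := x0 (inl (exist _ v vG)); rewrite !ffunE -extend_val.
apply/eqP/ffunP=> -[v|e]; rewrite !ffunE; last exact: xE (valP e).
by rewrite -extend_val; apply: xV (valP v).
Qed.

(** * Surjectivity of the rigidity map *)

(** Linear independence of the edge constraints on fields tangent to the cylinder, in dual form:
    each edge has a tangent field that stretches it and no other edge. *)
Definition independent_edges : Prop :=
  forall e, e \in edges G -> exists m : T -> 'cV[R]_4,
  [/\ forall v, v \in verts G -> dot (proj (m v)) (proj (q v)) = 0,
      forall f, f \in edges G -> f != e -> stretch m f = 0
    & stretch m e != 0].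

Lemma limg_rigidity_map :
  (forall v, v \in verts G -> q v \in @Sigma R) -> independent_edges ->
  limg (linfun rigidity_map) = fullv.
Proof.
move=> qS indep.
have dual (e : E) : exists x, rigidity_map x = [ffun i => (i == inr e)%:R].
  have [m [mV mE me]] := indep _ (valP e).
  exists ((stretch m (val e))^-1 *: [ffun v : V => m (val v)]).
  have strE (f : E) : stretch (extend [ffun v : V => m (val v)]) (val f) =
                     stretch m (val f).
    apply: eq_stretch => v vf; apply: extend_restrict.
    exact: subsetP (edge_sub (valP f)) v vf.
  rewrite linearZ; apply/ffunP=> -[v|f]; rewrite !ffunE.
    by rewrite mV ?scaler0 // (valP v).
  rewrite strE; have [[->]|fe] := eqVneq; first exact: mulVf.
  by rewrite (mE (val f)) ?scaler0 ?(valP f).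
have [x xE] := choice dual.
apply/vspaceP=> y; rewrite memvf; apply/memv_imgP.
(* [x0] has the prescribed normal components; the dual fields [x e] then correct the stretchings
   without changing those components. *)
pose x0 : {ffun V -> 'cV[R]_4} := [ffun v => y (inl v) *: q (val v)].
exists (x0 + \sum_e (y (inr e) - rigidity_map x0 (inr e)) *: x e); first exact: memvf.
rewrite lfunE /= linearD linear_sum /=; apply/ffunP=> i; rewrite ffunE sum_ffunE.
under eq_bigr do rewrite linearZ /= xE ffunE [X in _ *: X]ffunE.
case: i => [v|e].
  rewrite big1 => [|e _]; last by rewrite scaler0.
  by rewrite addr0 !ffunE linearZ dotZl (SigmaP _ (qS _ (valP v))) mulr1.
rewrite (bigD1 e) //= eqxx big1 => [|f fe]; last first.
  by rewrite (_ : (_ == _) = false) ?scaler0 //; apply: contraNF fe => /eqP[->].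
by rewrite addr0 -[_ *: _]/(_ * _) mulr1 addrC subrK.
Qed.

(** Rank-nullity: 4n is the kernel dimension plus n + |E|. *)
Lemma dim_lker_rigidity_map :
  (forall v, v \in verts G -> q v \in @Sigma R) -> independent_edges ->
  (\dim (lker (linfun rigidity_map)) + #|edges G| = 3 * #|verts G|)%N.
Proof.
move=> qS indep; have := limg_ker_dim (linfun rigidity_map) fullv.
rewrite capfv limg_rigidity_map // !dimvf.
rewrite -[dim {ffun V + E -> _}]/(#|{: V + E}| * 1)%N.
rewrite -[dim {ffun V -> _}]/(#|{: V}| * 4)%N.
rewrite card_sum !card_sig -[#|[pred x in edges G]|]/#|edges G| -[#|[pred x in verts G]|]/#|verts G|; lia.
Qed.

(** * Trivial flexes inside the kernel *)

Definition motion_restriction (k : 'cV[R]_4) : {ffun V -> 'cV[R]_4} :=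
  [ffun v => motion k (q (val v))].

Lemma motion_restriction_is_linear : linear motion_restriction.
Proof. by move=> a k l; apply/ffunP=> v; rewrite !ffunE motion_is_linear. Qed.
HB.instance Definition _ :=
  GRing.isLinear.Build R _ _ _ motion_restriction motion_restriction_is_linear.

(** The linear part of [motion k] is skew-symmetric, so relative velocities are orthogonal to
    relative positions. *)
Lemma inf_flex_motion k :
  (forall v, v \in verts G -> q v \in @Sigma R) ->
  inf_flex G q (fun v => motion k (q v)).
Proof.
move=> qS; split=> [u v _ | v vG]; last first.
  by have [_] := tangent_motion_motion k; apply; apply: qS.
by rewrite /dot sum_ord4 !mxE /=; ring.
Qed.

Lemma eq_inf_flex m m' : {in verts G, m =1 m'} -> inf_flex G q m -> inf_flex G q m'.
Proof.
move=> mm' /inf_flexP[mE mV]; apply/inf_flexP; split=> [e eG | v vG].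
  rewrite -(mE e eG); apply: eq_stretch => v ve.
  by rewrite mm' // (subsetP (edge_sub eG)).
by rewrite -mm' // mV.
Qed.

Lemma limg_motion_sub :
  (forall v, v \in verts G -> q v \in @Sigma R) ->
  (limg (linfun motion_restriction) <= lker (linfun rigidity_map))%VS.
Proof.
move=> qS; apply/subvP => _ /memv_imgP[k _ ->]; apply/lker_rigidity_map.
rewrite lfunE /=; apply: eq_inf_flex (inf_flex_motion k qS) => v vG.
exact: esym (extend_restrict (fun u => motion k (q u)) vG).
Qed.

Lemma dim_limg_motion : full G q -> \dim (limg (linfun motion_restriction)) = 4%N.
Proof.
move=> fullG; rewrite limg_dim_eq; first by rewrite dimvf.
(* Fullness makes the restriction injective, so all four parameters survive. *)
apply/eqP; rewrite capfv; apply/lker0P => k l; rewrite !lfunE /= => /ffunP kl.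
apply: motion_inj; apply: fullG; try exact: tangent_motion_motion.
by move=> v vG; have := kl (exist _ v vG); rewrite !ffunE.
Qed.

Lemma lker_rigidity_map_sub :
  inf_rigid G q ->
  (lker (linfun rigidity_map) <= limg (linfun motion_restriction))%VS.
Proof.
move=> rigid; apply/subvP => x /lker_rigidity_map/rigid[eta [/tangent_motionP[k etaE] xE]].
apply/memv_imgP; exists k; first exact: memvf.
by rewrite lfunE /=; apply/ffunP=> v; rewrite ffunE -etaE -xE ?extend_val ?(valP v).
Qed.

(** * Edge counts *)

Lemma leq_card_edges_independent :
  (forall v, v \in verts G -> q v \in @Sigma R) -> independent_edges ->
  full G q -> (#|edges G| + 4 <= 3 * #|verts G|)%N.
Proof.
move=> qS indep fullG; rewrite -dim_lker_rigidity_map // addnC leq_add2r.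
by have := dimvS (limg_motion_sub qS); rewrite dim_limg_motion.
Qed.

Lemma card_edges_rigid :
  (forall v, v \in verts G -> q v \in @Sigma R) -> independent_edges ->
  full G q -> inf_rigid G q -> (#|edges G| + 4 = 3 * #|verts G|)%N.
Proof.
move=> qS indep fullG rigid; apply/eqP.
rewrite eqn_leq leq_card_edges_independent // -dim_lker_rigidity_map //.
by have := dimvS (lker_rigidity_map_sub rigid); rewrite dim_limg_motion // addnC leq_add2l.
Qed.

Lemma card_edges_leq_bin : (#|edges G| <= 'C(#|verts G|, 2))%N.
Proof.
rewrite -cards_draws; apply/subset_leq_card/subsetP => e eG.
by rewrite inE edge_sub // edge_card.
Qed.

End RigidityMap.

(** * Independence from minimality, and tightness *)

Lemma independent_edges_subgraph (R : realType) (T : finType) (G H : sgraph T)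
    (q : T -> 'cV[R]_4) :
  subgraph H G -> independent_edges G q -> independent_edges H q.
Proof.
case/andP=> /subsetP sV /subsetP sE indep e /sE/indep[m [mV mE me]].
by exists m; split=> // [v /sV/mV | f /sE/mE].
Qed.

Lemma minimally_rigid_independent (R : realType) (T : finType) (G : sgraph T)
    (q : T -> 'cV[R]_4) :
  inf_rigid G q -> (forall e, e \in edges G -> ~ inf_rigid (del_edge G e) q) ->
  independent_edges G q.
Proof.
move=> rigid minl e eG.
have /existsNP[m /not_implyP[/inf_flexP[mE mV] mtriv]] := minl e eG.
exists m; split=> // [f fG fe | ]; first by apply: mE; rewrite !inE fe.
(* If [m] did not stretch [e], it would be a flex of [G], hence trivial, also for [del_edge G e],
   which has the same vertices. *)
apply/eqP => me; apply: mtriv; apply: rigid; apply/inf_flexP; split=> // f fG.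
by have [->//|fe] := eqVneq f e; apply: mE; rewrite !inE fe.
Qed.


Theorem theorem5p6 (R : realType) (T : finType) (G : sgraph T)
    (q : T -> 'cV[R]_4)
    (hV : (6 <= #|verts G|)%N)
    (hq : forall v, v \in verts G -> q v \in @Sigma R)
    (hfull : completely_full G q)
    (hrigid : inf_rigid G q)
    (hmin : forall e, e \in edges G -> ~ inf_rigid (del_edge G e) q) :
  tight34 G.
Proof.
have indep := minimally_rigid_independent hrigid hmin.
split.
  by apply: card_edges_rigid hrigid => //; apply: hfull; rewrite // /subgraph !subxx.
move=> H sHG; have [large|small] := leqP 6 #|verts H|.
  move=> _; apply: (leq_card_edges_independent (q := q)); last exact: hfull.
    by move=> v vH; apply: hq; case/andP: sHG => /subsetP sV _; apply: sV.
  exact: independent_edges_subgraph indep.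
(* The binomial bound first fails at n = 6, where 15 + 4 > 18. The left case, n < 2, is excluded
   because [H] has an edge. *)
have bin_small_n n : (n < 6 -> 'C(n, 2) = 0 \/ 'C(n, 2) + 4 <= 3 * n)%N.
  by case: n => [|[|[|[|[|[|//]]]]]]; by [left | right].
have := card_edges_leq_bin H; have := bin_small_n _ small; lia.
Qed.
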